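(* Let $T$ be a complete first-order theory with monster model $\mathfrak{C}$, and assume that forking (in $T$) has dual finite character. Let $A \subseteq B$ be (small) subsets of $\mathfrak{C}$. Let $p \in S(B)$ be a type that does not fork over $A$. Let $I$ be a (small) linearly ordered set. Then there is a Morley sequence $\mathbf{I} = \langle \bar{b}_i \mid i \in I \rangle$ for $p$ over $A$.
   Context: Setting: $T$ is a complete first-order theory in a language $L(T)$, and $\mathfrak{C}$ is its monster model, i.e. a $\kappa$-saturated, strongly $\kappa$-homogeneous model of $T$ for a suitably large cardinal $\kappa > |L(T)|+\aleph_0$. As usual, all sets of parameters and index sets are small (of cardinality less than $\kappa$), and all tuples and parameters are from $\mathfrak{C}$. A formula is over $A$ if it has parameters from $A$; $\models\phi[\bar{a}]$ means $\mathfrak{C}\models\phi[\bar{a}]$. $S(B)$ is the set of complete types over $B$ in finitely many variables (the variables of $p$ form a finite tuple). Forking: A formula $\phi(\bar{x},\bar{a})$ with parameters $\bar{a}$ divides over a set $A$ if there are $k<\omega$ and a sequence $\langle \bar{a}_i \mid i<\omega\rangle$ such that $\mathrm{tp}(\bar{a}_i/A)=\mathrm{tp}(\bar{a}/A)$ for all $i<\omega$ and $\{\phi(\bar{x},\bar{a}_i) \mid i<\omega\}$ is $k$-inconsistent (for any $i_1<\dots<i_k<\omega$, the formula $\bigwedge_{l=1}^{k}\phi(\bar{x},\bar{a}_{i_l})$ is not satisfiable in $\mathfrak{C}$). A type $p(\bar{x})$ forks over $A$ if there are finitely many formulas $\phi_0(\bar{x},\bar{a}_0),\dots,\phi_{n-1}(\bar{x},\bar{a}_{n-1})$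 (with parameters anywhere in $\mathfrak{C}$), each dividing over $A$, such that $p(\bar{x}) \vdash \bigvee_{l<n}\phi_l(\bar{x},\bar{a}_l)$. Dual finite character (DFC): forking has DFC if for every set $A$ and all finite tuples $\bar{b},\bar{c}$ such that $\mathrm{tp}(\bar{c}/A\bar{b})$ forks over $A$, there is a formula $\phi(\bar{x},\bar{y})$ over $A$ such that $\models\phi[\bar{c},\bar{b}]$, and for every tuple $\bar{b}'$ (of the same arity as $\bar{b}$), $\models\phi[\bar{c},\bar{b}']$ implies that $\mathrm{tp}(\bar{c}/A\bar{b}')$ forks over $A$. Morley sequences: Let $I$ be a linearly ordered set, $\mathbf{I}=\langle \bar{a}_i \mid i\in I\rangle$ a sequence of finite tuples of the same arity, $A\subseteq B$ sets, and $p\in S(B)$ a type that does not fork over $A$. Write $\bar{a}_{<i}$ for $(\bar{a}_j)_{j<i}$. $\mathbf{I}$ is an independent sequence for $p$ over $A$ if for all $i\in I$: (1) $\bar{a}_i\models p$, and (2) $\mathrm{tp}(\bar{a}_i/B\bar{a}_{<i})$ does not fork over $A$. $\mathbf{I}$ is a Morley sequence for $p$ over $A$ if it is an independent sequence for $p$ over $A$ and it is (order-)indiscernible over $B$. *)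

(* Defs.v *)
From mathcomp Require Import all_boot all_order.
From mathcomp Require Import boolp classical_sets functions cardinality.

Set Implicit Arguments.
Unset Strict Implicit.
Unset Printing Implicit Defensive.

Local Open Scope classical_set_scope.
Local Open Scope card_scope.

(* Cardinals are represented by types: a set is small for [K : Type] when its
   cardinality is strictly below that of [K]. *)
Definition small (K : Type) (U : Type) (X : set U) : Prop :=
  X #<= [set: K] /\ ~ ([set: K] #<= X).

Record language : Type := Language {
  fun_symb : Type;
  rel_symb : Type;
  fun_arity : fun_symb -> nat;
  rel_arity : rel_symb -> nat }.

(* Free variables range over an arbitrary type [V]; under a quantifier the bound
   variable is [None : option V]. In particular a formula over a set of parameters
   [A] in the variables [V], i.e. a formula of the language expanded by names for
   the elements of [A], is a term of type [formula L (V + A)]. *)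
Inductive term (L : language) (V : Type) : Type :=
| Var of V
| App (f : fun_symb L) of ('I_(fun_arity f) -> term L V).

Inductive formula (L : language) (V : Type) : Type :=
| Bot
| Equal of term L V & term L V
| Rel (r : rel_symb L) of ('I_(rel_arity r) -> term L V)
| Imp of formula L V & formula L V
| All of formula L (option V).

Definition Neg (L : language) (V : Type) (phi : formula L V) : formula L V :=
  Imp phi (Bot L V).

Record structure (L : language) : Type := Structure {
  carrier :> Type;
  carrier_inh : inhabited carrier;
  fun_int : forall f : fun_symb L, ('I_(fun_arity f) -> carrier) -> carrier;
  rel_int : forall r : rel_symb L, ('I_(rel_arity r) -> carrier) -> Prop }.

Fixpoint eval (L : language) (M : structure L) (V : Type) (v : V -> M)
    (t : term L V) : M :=
  match t with
  | Var x => v x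
  | App f args => fun_int (fun l => eval v (args l))
  end.

Definition extend (M V : Type) (v : V -> M) (m : M) : option V -> M :=
  fun o => if o is Some x then v x else m.

Fixpoint sat (L : language) (M : structure L) (V : Type) (phi : formula L V)
    (v : V -> M) : Prop :=
  match phi with
  | Bot => False
  | Equal s t => eval v s = eval v t
  | Rel r args => rel_int (fun l => eval v (args l))
  | Imp phi1 phi2 => sat phi1 v -> sat phi2 v
  | All phi1 => forall m : M, sat phi1 (extend v m)
  end.

Definition sentence (L : language) : Type := formula L void.

Definition holds (L : language) (M : structure L) (sigma : sentence L) : Prop :=
  sat sigma (of_void M).

Definition models (L : language) (M : structure L) (T : set (sentence L)) : Prop :=
  forall sigma, T sigma -> holds M sigma.

Definition entails (L : language) (T : set (sentence L)) (sigma : sentence L) : Prop :=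
  forall M : structure L, models M T -> holds M sigma.

Definition complete_theory (L : language) (T : set (sentence L)) : Prop :=
  (exists M : structure L, models M T) /\
  forall sigma : sentence L, entails T sigma \/ entails T (Neg sigma).

Definition copair (M V W : Type) (v : V -> M) (w : W -> M) : V + W -> M :=
  fun z => match z with inl x => v x | inr y => w y end.

Section Types.
Variables (L : language) (C : structure L).

(* The variables of a type form the type [V]; for an n-type, [V] is ['I_n]. *)
Definition realizes (V : Type) (A : set C) (c : V -> C)
    (p : set (formula L (V + A))) : Prop :=
  forall phi, p phi -> sat phi (copair c (fun a : A => val a)).

Definition tp (V : Type) (A : set C) (c : V -> C) : set (formula L (V + A)) :=
  [set phi | sat phi (copair c (fun a : A => val a))].

Arguments tp {V} A c.

(* Consistency of [p] with the theory of [C] with names for [A] is expressed as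
   finite satisfiability in [C]. *)
Definition complete_type (V : Type) (A : set C) (p : set (formula L (V + A))) : Prop :=
  (forall q, finite_set q -> q `<=` p -> exists c : V -> C, realizes c q) /\
  (forall phi, p phi \/ p (Neg phi)).

Definition saturated (K : Type) : Prop :=
  forall (A : set C) (n : nat) (p : set (formula L ('I_n + A))),
    small K A -> complete_type p -> exists c : 'I_n -> C, realizes c p.

(* Formulas whose variables are the elements of [A] express exactly the
   properties of finite tuples of elements of [A]. *)
Definition elementary_map (A : set C) (f : A -> C) : Prop :=
  forall phi : formula L A, sat phi (fun a : A => val a) <-> sat phi f.

Definition automorphism (g : C -> C) : Prop :=
  [/\ bijective g,
      forall (s : fun_symb L) args, g (fun_int (f := s) args) = fun_int (g \o args)
    & forall (r : rel_symb L) args, rel_int (r := r) args <-> rel_int (r := r) (g \o args)].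

Definition strongly_homogeneous (K : Type) : Prop :=
  forall (A : set C) (f : A -> C), small K A -> elementary_map f ->
    exists2 g : C -> C, automorphism g & forall a : A, g (val a) = f a.

Definition monster (K : Type) (T : set (sentence L)) : Prop :=
  [/\ models C T,
      small K [set: fun_symb L + rel_symb L + nat],
      saturated K
    & strongly_homogeneous K].

Definition inconsistent_family (V : Type) (k m : nat) (phi : formula L (V + 'I_m))
    (a : nat -> 'I_m -> C) : Prop :=
  forall i : 'I_k -> nat, (forall l l' : 'I_k, (l < l')%N -> (i l < i l')%N) ->
    ~ exists c : V -> C, forall l, sat phi (copair c (a (i l))).

Definition divides (V : Type) (A : set C) (m : nat) (phi : formula L (V + 'I_m))
    (a : 'I_m -> C) : Prop :=
  exists (k : nat) (a_ : nat -> 'I_m -> C),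
    (forall i, tp A (a_ i) = tp A a) /\
    inconsistent_family k phi a_.

(* The turnstile of a type over a small set is read in the monster model: every
   realization of [p] in [C] satisfies one of the dividing formulas. *)
Definition forks (V : Type) (B : set C) (A : set C) (p : set (formula L (V + B))) : Prop :=
  exists (N : nat) (m : 'I_N -> nat) (phi : forall l, formula L (V + 'I_(m l)))
      (a : forall l, 'I_(m l) -> C),
    (forall l, divides A (phi l) (a l)) /\
    (forall c : V -> C, realizes c p -> exists l, sat (phi l) (copair c (a l))).

Definition dual_finite_character (K : Type) : Prop :=
  forall (A : set C) (m n : nat) (b : 'I_m -> C) (c : 'I_n -> C),
    small K A ->
    forks A (tp (A `|` range b) c) ->
    exists phi : formula L (('I_n + 'I_m) + A),
      sat phi (copair (copair c b) (fun a : A => val a)) /\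
      forall b' : 'I_m -> C,
        sat phi (copair (copair c b') (fun a : A => val a)) ->
        forks A (tp (A `|` range b') c).

Section Sequences.
Variables (d : Order.disp_t) (I : orderType d) (n : nat).
Implicit Types (A B : set C) (b : I -> 'I_n -> C).

Definition before b (i : I) : set C :=
  \bigcup_(j in [set j | (j < i)%O]) range (b j).

Definition independent_sequence A B (p : set (formula L ('I_n + B))) b : Prop :=
  forall i : I,
    realizes (b i) p /\ ~ forks A (tp (B `|` before b i) (b i)).

Definition increasing (k : nat) (i : 'I_k -> I) : Prop :=
  forall l l' : 'I_k, (l < l')%N -> (i l < i l')%O.

(* The concatenation of k tuples of length n is indexed by ['I_k * 'I_n]. *)
Definition indiscernible B b : Prop :=
  forall (k : nat) (i j : 'I_k -> I), increasing i -> increasing j ->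
    tp B (fun x : 'I_k * 'I_n => b (i x.1) x.2) =
    tp B (fun x : 'I_k * 'I_n => b (j x.1) x.2).

Definition morley_sequence A B (p : set (formula L ('I_n + B))) b : Prop :=
  independent_sequence A p b /\ indiscernible B b.

End Sequences.
End Types.

(* Main.v *)
Require Import Defs.
From mathcomp Require Import all_boot all_order.
From mathcomp Require Import boolp classical_sets functions cardinality filter.

(* By compactness a type not forking over [A] extends to any small set without
   forking, so there is a sequence [a_0, a_1, ...] of realizations of [p] with
   [a_i] independent from [B a_(<i)] over [A]. Averaging along a nonprincipal
   ultrafilter on [nat] gives a [B]-indiscernible sequence [b] indexed by [I] such
   that every formula true of an increasing tuple of [b] is true of an increasing
   tuple of [a]. If [b_i] forked with [B b_(<i)] over [A], this would be witnessed by
   a finite tuple and, by dual finite character, by a formula over [A] that depends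
   only on [tp(b_i/A) = tp(a_j/A)]; this formula would also hold of some [a_j] and a
   finite tuple of [B a_(<j)], contradicting the independence of [a_j]. *)

Set Implicit Arguments.
Unset Strict Implicit.
Unset Printing Implicit Defensive.
Import Order.TTheory.

Local Open Scope classical_set_scope.
Local Open Scope card_scope.

(** * Small cardinals *)

Lemma card_le_inj (T U : Type) (A : set T) (B : set U) :
  A #<= B <-> exists f : A -> B, injective f.
Proof.
split=> [/card_leP/injfunPex[f _ fI]|[f fI]].
  by exists f => x y; apply: fI; rewrite inE.
by apply/card_leP/injfunPex; exists f => // x y _ _; apply: fI.
Qed.

Lemma card_leTT (T U : Type) :
  [set: T] #<= [set: U] <-> exists f : T -> U, injective f.
Proof.
split=> [/card_le_inj[f fI]|[f fI]].
  exists (fun x => val (f (SigSub (mem_set (I : [set: T] x))))) => x y.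
  by move=> /val_inj/fI[].
apply/card_leP/injfunPex.
exists (fun x : [set: T] => SigSub (mem_set (I : [set: U] (f (val x))))) => //.
by move=> x y _ _ [/fI/val_inj].
Qed.

(** Zorn's lemma applied to graphs of partial injections: a maximal graph has full domain or full
    range, since otherwise a pair of missed points could be added. *)
Lemma injective_total (T U : Type) :
  (exists f : T -> U, injective f) \/ (exists f : U -> T, injective f).
Proof.
pose P (G : set (T * U)) := forall p q, G p -> G q -> p.1 = q.1 <-> p.2 = q.2.
have [F FP Ftot|G [PG Gmax]] := @Zorn_bigcup (T * U) P.
  move=> p q [X FX Xp] [Y FY Yq].
  by case: (Ftot X Y FX FY) => [XY|YX];
    [apply: (FP Y) => //; apply: XY | apply: (FP X) => //; apply: YX].
have [Gx|/existsNP[x nGx]] := pselect (forall x, exists y, G (x, y)).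
  left; have [f fG] := choice Gx; exists f => x y fxy.
  by apply/(PG _ _ (fG x) (fG y)).
have [Gy|/existsNP[y nGy]] := pselect (forall y, exists x, G (x, y)).
  right; have [f fG] := choice Gy; exists f => u v fuv.
  by apply/(PG _ _ (fG u) (fG v)).
exfalso; apply: (Gmax (G `|` [set (x, y)])).
  split; first by left.
  by move=> /(_ (x, y) (or_intror erefl)) Gxy; apply: nGx; exists y.
move=> [p1 p2] [q1 q2] [Gp|[-> ->]] [Gq|[-> ->]] //=.
- exact: PG Gp Gq.
- by split=> e; exfalso;
    [apply: nGx; exists p2; rewrite -e|apply: nGy; exists p1; rewrite -e].
- by split=> e; exfalso;
    [apply: nGx; exists q2; rewrite e|apply: nGy; exists q1; rewrite e].
Qed.

(* Zorn: a maximal family [F] of disjoint copies of [nat] in [T] misses only a finite set. *)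
Lemma infinite_prod_nat (T : Type) :
  (exists f : nat -> T, injective f) -> exists f : T * nat -> T, injective f.
Proof.
move=> [h0 h0I].
pose P (F : set (nat -> T)) :=
  forall f g i j, F f -> F g -> f i = g j -> f = g /\ i = j.
have [F FP Ftot|F [PF Fmax]] := @Zorn_bigcup (nat -> T) P.
  move=> f g i j [X FX Xf] [Y FY Yg].
  by case: (Ftot X Y FX FY) => [XY|YX];
    [apply: (FP Y) => //; apply: XY | apply: (FP X) => //; apply: YX].
(* The points missed by all copies in [F]. If [R] were infinite, it would contain one more copy of
   [nat], against maximality. *)
pose R := [set y : T | forall f i, F f -> f i <> y].
have Rfin : finite_set R.
  apply: contrapT => /infiniteP/card_le_inj[h hI].
  pose h' i := val (h (SigSub (mem_set (I : [set: nat] i)))).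
  have h'I : injective h' by move=> i j /val_inj/hI[].
  have h'R i : R (h' i) by apply: set_valP.
  apply: (Fmax (F `|` [set h'])).
    split; first by left.
    by move=> /(_ h' (or_intror erefl)) /(h'R 0 _ 0)/(_ erefl).
  move=> f g i j [Ff|->] [Fg|->]; first exact: PF.
  - by move=> /(h'R j _ _ Ff).
  - by move=> /esym/(h'R i _ _ Fg).
  - by move=> /h'I.
have [f0 Ff0] : exists f, F f.
  apply: contrapT => nF; apply: (Fmax [set h0]).
    split; first by move=> f Ff; case: nF; exists f.
    by move=> /(_ h0 erefl) ?; case: nF; exists h0.
  by move=> f g i j -> -> /h0I.
have [g gI] := countable_injP _ (finite_set_countable Rfin).
(* A code of [y]: flag [true] with its copy and position there, or flag [false] with a fixed copy
   [f0] and the number of [y] in the finite set [R]. The pair of flag and number, together with [k],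
   is then packed into one position of the same copy. *)
pose Q y (q : (nat -> T) * (bool * nat)) := F q.1 /\
  (if q.2.1 then q.1 q.2.2 = y else R y /\ q.2.2 = g y).
have /choice[e eP] : forall y, exists q, Q y q.
  move=> y; have [[f [i [Ff fy]]]|nfy] :=
      pselect (exists f i, F f /\ f i = y); first by exists (f, (true, i)).
  exists (f0, (false, g y)); split=> //; split=> // f i Ff fy.
  by apply: nfy; exists f, i.
have eI : injective e.
  move=> x y; have := eP x; have := eP y.
  move: (e x) (e y) => [f [b i]] [f' [b' i']] /= [_ ey] [_ ex] [ff' bb' ii'].
  subst f' b' i'; case: b ex ey => [<- <- //|[Rx ->] [Ry]].
  by apply: gI; rewrite inE.
exists (fun yk => (e yk.1).1 (pickle ((e yk.1).2, yk.2))) => -[x k] [y l] /=.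
case/(PF _ _ _ _ (eP x).1 (eP y).1) => exy1 /(pcan_inj pickleK)[exy2 <-].
congr pair; apply: eI.
by rewrite [e x]surjective_pairing exy1 exy2 -surjective_pairing.
Qed.

Section Small.
Variable (K : Type).
Hypothesis natK : small K [set: nat].

Lemma small_le (U V : Type) (X : set U) (Y : set V) :
  X #<= Y -> small K Y -> small K X.
Proof.
move=> XY [YK KY]; split; first exact: card_le_trans YK.
by move=> KX; apply: KY; apply: card_le_trans XY.
Qed.

Lemma small_sub (U : Type) (X Y : set U) : X `<=` Y -> small K Y -> small K X.
Proof. by move=> /subset_card_le; apply: small_le. Qed.

Lemma small_image (U V : Type) (f : U -> V) (X : set U) :
  small K X -> small K (f @` X).
Proof. exact/small_le/card_image_le. Qed.

Lemma small_range (U V : Type) (f : U -> V) :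
  small K [set: U] -> small K (range f).
Proof. exact: small_image. Qed.

Lemma small_finite (U : Type) (X : set U) : finite_set X -> small K X.
Proof.
by move=> /finite_set_countable Xfin; apply: small_le natK.
Qed.

(** Either [nat] embeds in [V], which then absorbs the factor [nat], or [V] is countable and so is
    the product. *)
Lemma small_prod_nat (V : Type) :
  small K [set: V] -> small K [set: V * nat].
Proof.
move=> Vs; case: (injective_total nat V) => [/infinite_prod_nat|] [f fI].
  by apply: small_le Vs; apply/card_leTT; exists f.
apply: small_le natK; apply/card_leTT.
exists (fun vk => pickle (f vk.1, vk.2)) => -[v k] [w l].
by move=> /(pcan_inj pickleK)[/fI -> ->].
Qed.

Lemma small_setU (U : Type) (X Y : set U) :
  small K X -> small K Y -> small K (X `|` Y).
Proof.
wlog XY : X Y / exists f : X -> Y, injective f.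
  move=> H Xs Ys; have [XY|YX] := injective_total X Y; first exact: H.
  by rewrite setUC; apply: H.
case: XY => f fI _ Ys.
have YTs : small K [set: Y].
  by apply: small_le Ys; apply/card_le_inj; exists val; apply: val_inj.
apply: small_le (small_prod_nat YTs).
have XYmem z : (X `|` Y) z -> ~ X z -> z \in Y by case=> [//|]; rewrite inE.
pose h (z : (X `|` Y)) : Y * nat :=
  (* Tag 0 marks the points of [X], moved into [Y] by [f]; tag 1 marks the remaining points of
     [Y]. *)
  match pselect (X (val z)) with
  | left Xz => (f (SigSub (mem_set Xz)), 0)
  | right nXz => (SigSub (XYmem _ (set_valP z) nXz), 1)
  end.
have hI : injective h.
  move=> x y; rewrite /h.
  case: pselect => Xx; case: pselect => Xy // [].
    by move=> /fI[] /val_inj.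
  by move=> /val_inj.
apply/card_le_inj; exists (fun z => SigSub (mem_set (I : [set: Y * nat] (h z)))).
by move=> x y /(congr1 val)/hI.
Qed.

End Small.

(** * Definable sets *)

Section Rename.
Variable L : language.

Fixpoint term_rename (V W : Type) (r : V -> W) (t : term L V) : term L W :=
  match t with
  | Var x => Var L (r x)
  | App f args => App (fun l => term_rename r (args l))
  end.

Fixpoint rename (V W : Type) (r : V -> W) (phi : formula L V) : formula L W :=
  match phi with
  | Bot => Bot L W
  | Equal s t => Equal (term_rename r s) (term_rename r t)
  | Rel R args => Rel (fun l => term_rename r (args l))
  | Imp phi1 phi2 => Imp (rename r phi1) (rename r phi2)
  | All phi1 => All (rename (omap r) phi1)
  end.

Variable C : structure L.

Lemma eval_rename (V W : Type) (r : V -> W) (t : term L V) (w : W -> C) :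
  eval w (term_rename r t) = eval (w \o r) t.
Proof.
elim: t => [x|f args IH] //=; congr fun_int; apply/funext => l; exact: IH.
Qed.

Lemma sat_rename (V W : Type) (r : V -> W) (phi : formula L V) (w : W -> C) :
  sat (rename r phi) w <-> sat phi (w \o r).
Proof.
elim: phi W r w => {V} [|V s t|V R args|V f1 IH1 f2 IH2|V f IH] W r w //=.
- by rewrite !eval_rename.
- by under eq_fun do rewrite eval_rename.
- by rewrite IH1 IH2.
- split=> H m; have := H m; rewrite IH;
    suff -> : extend w m \o omap r = extend (w \o r) m by [];
    by apply/funext => -[].
Qed.

Lemma eval_support (V : Type) (t : term L V) :
  exists2 F : set V, finite_set F &
    forall v v' : V -> C, (forall x, F x -> v x = v' x) -> eval v t = eval v' t.
Proof.
elim: t => [x|f args IH] /=.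
  by exists [set x] => // v v' ->.
have /choice[F FP] : forall l, exists F : set V, finite_set F /\
    forall v v' : V -> C, (forall x, F x -> v x = v' x) ->
    eval v (args l) = eval v' (args l).
  by move=> l; have [F ? ?] := IH l; exists F.
exists (\bigcup_l F l).
  by apply: bigcup_finite => [|l _]; [apply: finite_finset|case: (FP l)].
move=> v v' vv'; congr fun_int; apply/funext => l.
by apply: (FP l).2 => x Fx; apply: vv'; exists l.
Qed.

Lemma sat_support (V : Type) (phi : formula L V) :
  exists2 F : set V, finite_set F &
    forall v v' : V -> C, (forall x, F x -> v x = v' x) -> sat phi v -> sat phi v'.
Proof.
(* The equivalence is needed for the induction, as [Imp] reverses its premise. *)
suff [F Ffin FP] : exists2 F : set V, finite_set F &
    forall v v' : V -> C, (forall x, F x -> v x = v' x) -> sat phi v <-> sat phi v'.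
  by exists F => // v v' /FP[].
elim: phi => {V} [V|V s t|V R args|V f1 [F Ff FP] f2 [G Gf GP]|V f [F Ff FP]] /=.
- by exists set0.
- have [F Ff FP] := eval_support s; have [G Gf GP] := eval_support t.
  exists (F `|` G); first by rewrite finite_setU.
  move=> v v' vv'; rewrite (FP v v') ?(GP v v') // => x ?; apply: vv'.
    by right.
  by left.
- have /choice[F FP] : forall l, exists F : set V, finite_set F /\
      forall v v' : V -> C, (forall x, F x -> v x = v' x) ->
      eval v (args l) = eval v' (args l).
    by move=> l; have [F ? ?] := eval_support (args l); exists F.
  exists (\bigcup_l F l).
    by apply: bigcup_finite => [|l _]; [apply: finite_finset|case: (FP l)].
  move=> v v' vv'.
  suff -> : (fun l => eval v (args l)) = (fun l => eval v' (args l)) by [].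
  by apply/funext => l; apply: (FP l).2 => x Fx; apply: vv'; exists l.
- exists (F `|` G); first by rewrite finite_setU.
  move=> v v' vv'; rewrite (FP v v') ?(GP v v') // => x ?; apply: vv'.
    by right.
  by left.
- exists (Some @^-1` F).
    by apply: finite_preimage Ff => x y _ _ [].
  by move=> v v' vv'; split=> H m; have := H m; apply: (FP _ _ _).1 => -[x /= /vv'|].
Qed.

Lemma ex_closure (k : nat) (W : Type) (phi : formula L ('I_k + W)) :
  exists psi : formula L W, forall w : W -> C,
    sat psi w <-> exists u : 'I_k -> C, sat phi (copair u w).
Proof.
elim: k => [|k IH] in phi *.
  pose r (z : 'I_0 + W) : W :=
    match z with inl (Ordinal _ i0) => False_rect W (notF i0) | inr y => y end.
  exists (rename r phi) => w; rewrite sat_rename.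
  have E u : w \o r = copair u w by apply/funext => -[[]|].
  split=> [H|[u]]; last by rewrite -E.
  have u : 'I_0 -> C by case.
  by exists u; rewrite -E.
(* The first variable becomes the bound variable [None]; the others shift down by one and are
   quantified by induction. *)
pose r (z : 'I_k.+1 + W) : option ('I_k + W) :=
  match z with
  | inl i => omap inl (unlift ord0 i)
  | inr y => Some (inr y)
  end.
have [psi psiP] := IH (Neg (All (Neg (rename r phi)))).
exists psi => w; rewrite psiP; split=> [[u /= nH]|[u Hu]].
  apply: contrapT => nex; apply: nH => m; rewrite sat_rename => H; apply: nex.
  exists (fun i => if unlift ord0 i is Some j then u j else m).
  congr (sat phi _): H; apply/funext => -[i|y] //=.
  by case: unlift.
exists (u \o lift ord0) => /= /(_ (u ord0)); apply; rewrite sat_rename.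
congr (sat phi _): Hu; apply/funext => -[i|y] //=.
by case: unliftP => [j|] ->.
Qed.

End Rename.

Section Definable.
Variables (L : language) (C : structure L).

(** Formulas over [X] are handled through their solution sets, so that connectives become set
    operations and substitutions become preimages. *)
Definition definable (V : Type) (X : set C) (S : set (V -> C)) :=
  exists phi : formula L (V + X), forall v, S v <-> sat phi (copair v val).

Lemma definableC (V : Type) (X : set C) (S : set (V -> C)) :
  definable X S -> definable X (~` S).
Proof. by move=> [phi phiP]; exists (Neg phi) => v /=; rewrite -phiP. Qed.

Lemma definableT (V : Type) (X : set C) : definable X [set: V -> C].
Proof. by exists (Neg (Bot _ _)) => v; split=> /=. Qed.

Lemma definableI (V : Type) (X : set C) (S S' : set (V -> C)) :
  definable X S -> definable X S' -> definable X (S `&` S').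
Proof.
move=> [phi phiP] [psi psiP]; exists (Neg (Imp phi (Neg psi))) => v /=.
rewrite -phiP -psiP; split=> [[Sv S'v]|H]; first by apply.
by split; apply: contrapT => nS; apply: H => // ?.
Qed.

Lemma definableU (V : Type) (X : set C) (S S' : set (V -> C)) :
  definable X S -> definable X S' -> definable X (S `|` S').
Proof.
rewrite -[S `|` S']setCK setCU => /definableC ? /definableC ?.
exact/definableC/definableI.
Qed.

(** Semantic form of substitution: each variable is replaced by a variable or by a parameter from
    [Y], according to what [h] does at that coordinate. *)
Lemma definable_preimage (V W : Type) (X Y : set C) (h : (W -> C) -> V -> C)
    (S : set (V -> C)) :
  X `<=` Y ->
  (forall x, (exists y, forall w, h w x = w y) \/
             (exists2 a, Y a & forall w, h w x = a)) ->
  definable X S -> definable Y (h @^-1` S).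
Proof.
move=> XY hP [phi phiP].
have /choice[r rP] : forall z : V + X, exists z' : W + Y,
    forall w : W -> C, copair w val z' = copair (h w) val z.
  move=> [x|a].
    case: (hP x) => [[y hy]|[a Ya ha]]; first by exists (inl y) => w; rewrite /= hy.
    by exists (inr (SigSub (mem_set Ya))) => w; rewrite /= ha.
  by exists (inr (SigSub (mem_set (XY _ (set_valP a))))).
exists (rename r phi) => w; rewrite sat_rename -[(h @^-1` S) w]/(S (h w)) phiP.
by suff -> : copair w val \o r = copair (h w) val by []; apply/funext => z /=.
Qed.

Lemma definable_sub (V : Type) (X Y : set C) (S : set (V -> C)) :
  X `<=` Y -> definable X S -> definable Y S.
Proof.
by move=> XY; apply: (@definable_preimage _ _ _ _ id) => // x; left; exists x.
Qed.

Lemma definable_support (V : Type) (X : set C) (S : set (V -> C)) :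
  definable X S -> exists2 F : set V, finite_set F &
    forall v v', (forall x, F x -> v x = v' x) -> S v -> S v'.
Proof.
move=> [phi phiP]; have [F Ff FP] := sat_support C phi.
exists (inl @^-1` F); first by apply: finite_preimage Ff => x y _ _ [].
by move=> v v' vv' /phiP H; apply/phiP; apply: FP H => -[x /vv'|].
Qed.

Lemma definable_ex (V W : Type) (X : set C) (S : set (V + W -> C)) :
  definable X S -> definable X [set w | exists v, S (copair v w)].
Proof.
move=> Sdef; have [F Ff FP] := definable_support Sdef; case: Sdef => phi phiP.
have {}Ff : finite_set (inl @^-1` F) by apply: finite_preimage Ff => x y _ _ [].
have /(@finite_seqP {classic V})[s sE] := Ff.
have [c0] := carrier_inh C.
(* Only the variables in the finite support [s] matter; they are numbered by position. All others
   share the extra index [size s]. *)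
pose r (z : (V + W) + X) : 'I_(size s).+1 + (W + X) :=
  match z with
  | inl (inl x) => inl (inord (index (x : {classic V}) s))
  | inl (inr y) => inr (inl y)
  | inr a => inr (inr a)
  end.
have [psi psiP] := ex_closure C (rename r phi).
exists psi => w; rewrite psiP; split=> [[v Sv]|[u]].
  exists (fun i => nth c0 [seq v x | x <- s] i); rewrite sat_rename.
  have {Sv} /phiP : S (copair (fun x : V => nth c0 [seq v x | x <- s]
      (inord (index (x : {classic V}) s) : 'I_(size s).+1)) w).
    apply: FP Sv => -[x Fx|] //=.
    have xs : (x : {classic V}) \in s by have : (inl @^-1` F) x := Fx; rewrite sE.
    rewrite inordK ?ltnS ?index_size //.
    by rewrite (nth_map (x : {classic V})) ?index_mem // nth_index.
  move=> H; congr (sat phi _): H.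
  by apply/funext => -[[x|y]|a].
rewrite sat_rename => H.
exists (fun x => u (inord (index (x : {classic V}) s))); apply/phiP.
congr (sat phi _): H.
by apply/funext => -[[x|y]|a].
Qed.

Lemma definable_finite (V : Type) (X : set C) (S : set (V -> C)) :
  definable X S -> exists Y : set C, [/\ finite_set Y, Y `<=` X & definable Y S].
Proof.
move=> Sdef; have [X0|/set0P[a0 Xa0]] := eqVneq X set0.
  by exists set0; split; rewrite -?X0 // X0; apply: finite_set0.
case: Sdef => phi phiP; have [F Ff FP] := sat_support C phi.
(* The element [a0] is a default to which the parameters outside the support are renamed. *)
pose Y := a0 |` (val @` (inr @^-1` F : set X)).
have YP (z : V + X) : exists z' : V + Y, F z -> forall v : V -> C,
    copair v val z' = copair v val z.
  case: z => [x|a]; first by exists (inl x).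
  have [Ya|nYa] := pselect (Y (val a)).
    by exists (inr (SigSub (mem_set Ya))).
  have Ya0 : Y a0 by left.
  by exists (inr (SigSub (mem_set Ya0))) => Fa; case: nYa; right; exists a.
have [r rP] := choice YP.
exists Y; split.
- rewrite finite_setU; split; first exact: finite_set1.
  by apply/finite_image/finite_preimage => // x y _ _ [].
- by move=> _ [->|[a _ <-]] //; apply: set_valP.
exists (rename r phi) => v; rewrite sat_rename phiP.
by split; apply: FP => z /= Fz; rewrite rP.
Qed.
End Definable.

(** * Compactness over small variable sets *)

Definition filter_base (T : Type) (F : set (set T)) : Prop :=
  [/\ F !=set0,
      forall S S', F S -> F S' -> exists2 S'', F S'' & S'' `<=` S `&` S'
    & forall S, F S -> S !=set0].

Section Compactness.
Variables (L : language) (C : structure L) (K : Type).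
Hypotheses (natK : small K [set: nat]) (Csat : saturated C K).

(** The family extends to an ultrafilter; the formulas over [X] whose solution sets belong to it
    form a complete type, which saturation realizes. *)
Lemma compactness_fin (n : nat) (X : set C) (F : set (set ('I_n -> C))) :
  small K X -> filter_base F -> (forall S, F S -> definable X S) ->
  exists c, forall S, F S -> S c.
Proof.
move=> Xs [[S0 FS0] FI Fn0] Fdef.
have FF : ProperFilter (filter_from F id).
  by apply: filter_from_proper => //; apply: filter_from_filter => //; exists S0.
have [G [GU FG]] := ultraFilterLemma FF.
pose D (phi : formula L ('I_n + X)) := [set c : 'I_n -> C | sat phi (copair c val)].
have [|c cP] := @Csat X n [set phi | G (D phi)] Xs.
  split=> [q qfin qG|phi]; last by apply: in_ultra_setVsetC.
  have /(@finite_seqP {classic (formula L ('I_n + X))})[s sE] := qfin.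
  have sG phi : phi \in s -> G (D phi) by move=> phis; apply: qG; rewrite sE.
  have /filter_ex[c cP] : G [set c | forall phi, phi \in s -> D phi c].
    elim: s sG {sE} => [|phi s IH] sG; first by apply: filterS filterT.
    have Gs : G [set c | forall phi, phi \in s -> D phi c].
      by apply: IH => psi psis; apply: sG; rewrite inE psis orbT.
    apply: filterS (filterI (sG phi (mem_head _ _)) Gs) => c [phic sc] psi.
    by rewrite inE => /orP[/eqP->|/sc].
  by exists c => phi qphi; apply: cP; rewrite sE in qphi.
exists c => S FS; have [phi phiP] := Fdef S FS.
apply/phiP/cP; rewrite /= /D.
have -> : [set c | sat phi (copair c val)] = S by apply/seteqP; split=> ? /phiP.
by apply: FG; exists S.
Qed.

(** Used for the chain condition in Zorn's lemma below: a definable set sees finitely many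
    variables, and their values in the union of a chain already occur in one member. *)
Lemma chain_finite (T U : Type) (H : set (set (T * U))) (s : seq {classic T}) :
  H !=set0 -> total_on H subset ->
  (forall x y y', (\bigcup_(G in H) G) (x, y) ->
    (\bigcup_(G in H) G) (x, y') -> y = y') ->
  exists2 G, H G & forall x y, x \in s -> (\bigcup_(G in H) G) (x, y) -> G (x, y).
Proof.
move=> [G0 HG0] Htot Hfun; elim: s => [|x s [G HG GP]]; first by exists G0.
have [[y [G' HG' G'xy]]|nx] :=
  pselect (exists y, (\bigcup_(G in H) G) (x, y)); last first.
  exists G => // x' y; rewrite inE => /orP[/eqP-> ?|]; last exact: GP.
  by case: nx; exists y.
have xyP y' : (\bigcup_(G in H) G) (x, y') -> G' (x, y').
  by move=> /(Hfun x y y') <- //; exists G'.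
case: (Htot G G' HG HG') => [GG'|G'G]; [exists G'|exists G] => // x' y';
  rewrite inE => /orP[/eqP->|x's] Ux'.
- exact: xyP.
- exact/GG'/GP.
- exact/G'G/xyP.
- exact: GP.
Qed.

(* Saturation only realizes types in finitely many variables: a maximal partial
   assignment [G] that is compatible with every member of [F] is total. *)
Lemma compactness (V : Type) (X : set C) (F : set (set (V -> C))) :
  small K [set: V] -> small K X -> filter_base F ->
  (forall S, F S -> definable X S) ->
  exists c, forall S, F S -> S c.
Proof.
move=> Vs Xs [[S0 FS0] FI Fn0] Fdef; have [c0] := carrier_inh C.
pose P (G : set (V * C)) := forall S, F S ->
  exists2 v, S v & forall x c, G (x, c) -> v x = c.
have Pfun G x c c' : P G -> G (x, c) -> G (x, c') -> c = c'.
  by move=> /(_ S0 FS0)[v _ vP] /vP <- /vP <-.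
have [H HP Htot|G [PG Gmax]] := @Zorn_bigcup (V * C) P.
  have [[G1 HG1]|H0] := pselect (H !=set0); last first.
    move=> S /Fn0[v Sv]; exists v => // x c [G HG]; case: H0; by exists G.
  have Hfun x y y' : (\bigcup_(G in H) G) (x, y) ->
      (\bigcup_(G in H) G) (x, y') -> y = y'.
    move=> [G HG Gxy] [G' HG' G'xy'].
    case: (Htot G G' HG HG') => [GG'|G'G].
      by apply: (Pfun G' x) => //; [apply: HP|apply: GG'].
    by apply: (Pfun G x) => //; [apply: HP|apply: G'G].
  move=> S FS.
  have [E /(@finite_seqP {classic V})[s sE] EP] := definable_support (Fdef S FS).
  have [G HG GP] := chain_finite s (ex_intro _ G1 HG1) Htot Hfun.
  have [v Sv vG] := HP G HG S FS.
  (* Membership in [S] depends only on the values at [s], so elsewhere [v] may be overwritten by the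
     values that the union prescribes. *)
  exists (fun x => if pselect ((x : {classic V}) \in s) then v x else
    if pselect (exists c, (\bigcup_(G in H) G) (x, c)) is left h
    then projT1 (cid h) else v x).
    by apply: EP Sv => x; rewrite sE /= => xs; case: pselect.
  move=> x c Ux; case: pselect => [xs|nxs]; first exact/vG/GP.
  case: pselect => [h|[]]; last by exists c.
  by apply: (Hfun x) => //; case: cid.
have [Gx|/existsNP[x nGx]] := pselect (forall x, exists c, G (x, c)).
  have [f fG] := choice Gx; exists f => S /PG[v Sv vG].
  by have -> : f = v by apply/funext => x; rewrite (vG _ _ (fG x)).
exfalso.
have [g gP] : exists g : V -> C, forall y c, G (y, c) -> g y = c.
  by have [v _ vP] := PG S0 FS0; exists v.
(* The new variable fills [x], the domain of [G] keeps its values as parameters, and the remaining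
   variables are quantified away in [F1]. This leaves a problem in one variable. *)
pose h (w : V + 'I_1 -> C) (y : V) : C :=
  if `[< y = x >] then w (inr ord0) else
  if `[< exists c, G (y, c) >] then g y else w (inl y).
pose Y := X `|` range g.
pose F1 := [set T : set ('I_1 -> C) | exists2 S, F S &
              T = [set a | exists v : V -> C, S (h (copair v a))]].
have F1def T : F1 T -> definable Y T.
  move=> [S FS ->]; apply: (@definable_ex _ _ _ _ _ (h @^-1` S)).
  apply: (@definable_preimage _ _ _ _ X Y h S) => [|y|]; [by left| |exact: Fdef].
  rewrite /h; case: asboolP => _; first by left; exists (inr ord0).
  case: asboolP => _; last by left; exists (inl y).
  by right; exists (g y) => //; right; exists y.
have [a aP] : exists a, forall T, F1 T -> T a.
  apply: compactness_fin F1def; first by apply: small_setU => //; apply: small_range.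
  split.
  + by exists [set a | exists v : V -> C, S0 (h (copair v a))], S0.
  + move=> _ _ [S FS ->] [S' FS' ->]; have [S'' FS'' SS] := FI S S' FS FS'.
    exists [set a | exists v : V -> C, S'' (h (copair v a))]; first by exists S''.
    by move=> a [v /SS[? ?]]; split; exists v.
  + move=> _ [S FS ->]; have [v Sv vG] := PG S FS; exists (fun=> v x), v.
    suff -> : h (copair v (fun=> v x)) = v by [].
    apply/funext => y; rewrite /h; case: asboolP => [->//|_].
    by case: asboolP => // -[c Gyc]; rewrite (vG _ _ Gyc); apply: gP.
apply: (Gmax (G `|` [set (x, a ord0)])).
  split; first by left.
  by move=> /(_ (x, a ord0) (or_intror erefl)) Gxa; apply: nGx; exists (a ord0).
move=> S FS; have [|v Sv] := aP [set a | exists v : V -> C, S (h (copair v a))].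
  by exists S.
exists (h (copair v a)) => // y c [Gyc|[-> ->]]; last by rewrite /h; case: asboolP.
rewrite /h; case: asboolP => [yx|_]; first by case: nGx; exists c; rewrite -yx.
by case: asboolP => [_|[]]; [apply: gP|exists c].
Qed.

End Compactness.

(** * Forking *)

Arguments tp {L C V} A c.

Section Forked.
Variables (L : language) (C : structure L).

Lemma tp_definable (V : Type) (X : set C) (c c' : V -> C) :
  tp X c = tp X c' <-> forall S, definable X S -> S c -> S c'.
Proof.
split=> [E S [phi phiP] /phiP Hc|H].
  by apply/phiP; have : tp X c phi by []; rewrite E.
apply/seteqP; split=> phi.
  by apply: (H [set v | sat phi (copair v val)]); exists phi.
move=> /= Hc'; apply: contrapT => nHc.
have [] // := H [set v | ~ sat phi (copair v val)]; first by exists (Neg phi).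
Qed.

Lemma realizes_tp (V : Type) (X : set C) (c c' : V -> C) :
  realizes c' (tp X c) <-> tp X c = tp X c'.
Proof.
split=> [H|E phi]; last by rewrite E.
by apply/tp_definable => S [phi phiP] /phiP/H/phiP.
Qed.

Lemma tp_sub (V : Type) (X Y : set C) (c c' : V -> C) :
  X `<=` Y -> tp Y c = tp Y c' -> tp X c = tp X c'.
Proof.
by move=> XY /tp_definable H; apply/tp_definable => S /(definable_sub XY)/H.
Qed.

Definition instance (V : Type) : Type :=
  {m : nat & (formula L (V + 'I_m) * ('I_m -> C))%type}.

Definition instance_set (V : Type) (q : instance V) : set (V -> C) :=
  [set c | sat (projT2 q).1 (copair c (projT2 q).2)].

(** The forking ideal over [A], on arbitrary sets of assignments rather than on types. *)
Definition forked (V : Type) (A : set C) (W : set (V -> C)) : Prop :=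
  exists (N : nat) (q : 'I_N -> instance V),
    (forall l, divides A (projT2 (q l)).1 (projT2 (q l)).2) /\
    W `<=` \bigcup_l instance_set (q l).

Lemma forksE (V : Type) (A B : set C) (p : set (formula L (V + B))) :
  forks A p <-> forked A [set c | realizes c p].
Proof.
split=> [[N [m [phi [a [dv H]]]]]|[N [q [dv H]]]].
  exists N, (fun l => existT _ (m l) (phi l, a l)); split=> // c /H[l Hl].
  by exists l.
exists N, (fun l => projT1 (q l)), (fun l => (projT2 (q l)).1),
  (fun l => (projT2 (q l)).2); split=> // c /H[l _ Hl].
by exists l.
Qed.

Lemma forked_sub (V : Type) (A : set C) (W W' : set (V -> C)) :
  W `<=` W' -> forked A W' -> forked A W.
Proof.
move=> WW' [N [q [dv H]]]; exists N, q; split=> //.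
exact: subset_trans H.
Qed.

Lemma forked0 (V : Type) (A : set C) : forked A (set0 : set (V -> C)).
Proof.
have q : 'I_0 -> instance V by case.
by exists 0, q; split=> // -[].
Qed.

Lemma forkedU (V : Type) (A : set C) (W W' : set (V -> C)) :
  forked A W -> forked A W' -> forked A (W `|` W').
Proof.
move=> [N [q [dv H]]] [N' [q' [dv' H']]].
exists (N + N')%N,
  (fun l => match fintype.split l with inl i => q i | inr j => q' j end).
split=> [l|c [/H[i _ Hi]|/H'[i _ Hi]]]; first by case: fintype.split.
  by exists (lshift N' i) => //; rewrite (unsplitK (inl i)).
by exists (rshift N i) => //; rewrite (unsplitK (inr i)).
Qed.

Lemma instance_definable (V : Type) (q : instance V) :
  definable (range (projT2 q).2) (instance_set q).
Proof.
case: q => m [phi a]; rewrite /instance_set /=.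
pose r (z : V + 'I_m) : V + range a :=
  match z with inl x => inl x | inr i => inr (SigSub (mem_set (imageT a i))) end.
exists (rename r phi) => v; rewrite sat_rename /=.
by have -> : copair v a = copair v val \o r by apply/funext => -[].
Qed.

(** The set [U] is the union of the dividing instances covering [W]; finitely many instances involve
    finitely many parameters. *)
Lemma forked_definable (V : Type) (A : set C) (W : set (V -> C)) :
  forked A W -> exists Y U, [/\ finite_set Y, definable Y U, W `<=` U & forked A U].
Proof.
move=> [N [q [dv WU]]].
exists (\bigcup_l range (projT2 (q l)).2), (\bigcup_l instance_set (q l)); split=> //.
- apply: bigcup_finite => [|l _]; first exact: finite_finset.
  exact/finite_image/finite_finset.
- have qdef l : definable (\bigcup_l range (projT2 (q l)).2) (instance_set (q l)).
    by apply: definable_sub (instance_definable (q l)) => a qa; exists l.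
  rewrite -[X in definable _ X]setCK setC_bigcup.
  apply: definableC; move: (\bigcup_l _) qdef => Y {dv WU}.
  elim: N q => [|N IH] q qdef.
    suff -> : \bigcap_l ~` instance_set (q l) = setT by exact: definableT.
    by apply/seteqP; split=> [//|c _ [i i0]]; have := i0; rewrite ltn0.
  suff -> : \bigcap_l ~` instance_set (q l) = ~` instance_set (q ord0) `&`
      \bigcap_l ~` instance_set (q (lift ord0 l)).
    apply: definableI; first exact: definableC.
    by apply: (IH (q \o lift ord0)) => l; apply: qdef.
  apply/seteqP; split=> [c H|c [H0 H] l _].
    by split=> [|l _]; apply: H.
  by case: (unliftP ord0 l) => [j|] ->; [apply: H|].
- by exists N, q; split.
Qed.

Lemma sat_automorphism (g : C -> C) (V : Type) (phi : formula L V) (v : V -> C) :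
  automorphism g -> sat phi (g \o v) <-> sat phi v.
Proof.
move=> [gbij gfun grel].
have gE W (t : term L W) (w : W -> C) : eval (g \o w) t = g (eval w t).
  elim: t => [//|f args IH] /=; rewrite gfun; congr fun_int.
  by apply/funext => l /=; rewrite IH.
have [h gK hK] := gbij.
elim: phi v => {V} [V|V s t|V R args|V f1 IH1 f2 IH2|V f IH] v //=.
- by rewrite !gE; split=> [/(can_inj gK)|->].
- by under eq_fun do rewrite gE; rewrite [X in _ <-> X]grel.
- by rewrite IH1 IH2.
- have E m : extend (g \o v) (g m) = g \o extend v m by apply/funext => -[].
  split=> H m; first by apply/IH; rewrite -E.
  by rewrite -(hK m) E IH.
Qed.

Section Automorphism.
Variables (A : set C) (g : C -> C).
Hypotheses (gaut : automorphism g) (gA : forall a, A a -> g a = a).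

Lemma tp_automorphism (V : Type) (c : V -> C) : tp A (g \o c) = tp A c.
Proof.
have E : copair (g \o c) (val : A -> C) = g \o copair c val.
  by apply/funext => -[//|a] /=; rewrite gA //; apply: set_valP.
rewrite /tp E; apply/seteqP; split=> phi.
  exact: (sat_automorphism phi (copair c val) gaut).1.
exact: (sat_automorphism phi (copair c val) gaut).2.
Qed.

(** Dividing depends on the parameters only through their type over [A], which [g] preserves; hence
    the same sequences [a_] witness it after moving. *)
Lemma forked_automorphism (V : Type) (W : set (V -> C)) :
  forked A W -> forked A ((fun c => g \o c) @` W).
Proof.
move=> [N [q [dv H]]].
exists N, (fun l => existT _ (projT1 (q l)) ((projT2 (q l)).1, g \o (projT2 (q l)).2)).
split=> [l|_ [c /H[l _ Hl] <-]] /=.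
  have [k [a_ [aE ai]]] := dv l.
  by exists k, a_; split=> // i; rewrite aE tp_automorphism.
exists l => //; move: Hl; rewrite /instance_set /= -(sat_automorphism _ _ gaut).
by congr sat; apply/funext => -[].
Qed.

Lemma definable_automorphism (V : Type) (X : set C) (S : set (V -> C)) :
  definable X S -> definable (g @` X) ((fun c => g \o c) @` S).
Proof.
move=> [phi phiP]; case: (gaut) => [[h gK hK] _ _].
pose r (z : V + X) : V + g @` X :=
  match z with
  | inl x => inl x
  | inr a => inr (SigSub (mem_set (imageP g (set_valP a))))
  end.
exists (rename r phi) => v; rewrite sat_rename.
have -> : copair v val \o r = g \o copair (h \o v) val.
  by apply/funext => -[x|a] //=; rewrite hK.
rewrite (sat_automorphism _ _ gaut) -phiP; split=> [[c Sc <-]|Shv].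
  by suff -> : h \o (g \o c) = c by []; apply/funext => x /=; rewrite gK.
by exists (h \o v) => //; apply/funext => x /=; rewrite hK.
Qed.

End Automorphism.

Variable K : Type.
Hypotheses (natK : small K [set: nat]) (Csat : saturated C K).

Lemma tp_extends_forked (V : Type) (A X : set C) (c : V -> C) (S : set (V -> C)) :
  definable X S -> S c -> forked A S -> forks A (tp X c).
Proof.
move=> Sdef Sc Sf; apply/forksE; apply: forked_sub Sf => c' /realizes_tp/tp_definable.
exact.
Qed.

(** Let [U] be a forking definable set containing all realizations of the type. If no definable set
    of the type forked, each would meet the complement of [U], and compactness would give a
    realization outside [U]. *)
Lemma forks_formula (V : Type) (A X : set C) (c : V -> C) :
  small K [set: V] -> small K X -> forks A (tp X c) ->
  exists S, [/\ definable X S, S c & forked A S].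
Proof.
move=> Vs Xs /forksE/forked_definable[Y [U [Yfin Udef cU Uf]]].
apply: contrapT => nS.
pose F := [set S' | exists S, [/\ definable X S, S c & S' = S `&` ~` U]].
have [c' c'F] : exists c', forall S, F S -> S c'.
  apply: (compactness natK Csat (X := X `|` Y)) => //.
  - by apply: small_setU => //; apply: small_finite.
  - split.
    + by exists (setT `&` ~` U), setT; split=> //; apply: definableT.
    + move=> _ _ [S [Sd Sc ->]] [S' [Sd' Sc' ->]].
      exists ((S `&` S') `&` ~` U); last by move=> x [[? ?] ?].
      by exists (S `&` S'); split=> //; apply: definableI.
    + move=> _ [S [Sd Sc ->]]; apply: contrapT => /forallNP SU; apply: nS; exists S.
      split=> //; apply: forked_sub Uf => x Sx; apply: contrapT => nUx.
      by case: (SU x).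
  - move=> _ [S [Sd Sc ->]]; apply: definableI; first exact: definable_sub Sd.
    by apply: definableC; apply: definable_sub Udef.
have [_ nU] : ([set: V -> C] `&` ~` U) c'.
  by apply: c'F; exists setT; split=> //; apply: definableT.
apply/nU/cU/realizes_tp/tp_definable => S Sd Sc.
by have [] : (S `&` ~` U) c' by apply: c'F; exists S.
Qed.

(** Compactness is applied to the sets of the type minus the forking sets definable over [X]. Such a
    difference is nonempty because a set of the type contained in a forking set would itself
    fork. *)
Lemma nonforking_extension (V : Type) (A B X : set C) (c0 : V -> C) :
  small K [set: V] -> small K X -> B `<=` X -> ~ forks A (tp B c0) ->
  exists c, tp B c0 = tp B c /\ ~ forks A (tp X c).
Proof.
move=> Vs Xs BX nf.
pose F := [set S' | exists S W, [/\ definable B S, S c0, definable X W, forked A W &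
  S' = S `&` ~` W]].
have [c cF] : exists c, forall S, F S -> S c.
  apply: (compactness natK Csat (X := X)) => //.
  - split.
    + exists (setT `&` ~` set0), setT, set0; split=> //; first exact: definableT.
        by rewrite -[set0]setCK setC0; apply/definableC/definableT.
      exact: forked0.
    + move=> _ _ [S [W [Sd Sc Wd Wf ->]]] [S' [W' [Sd' Sc' Wd' Wf' ->]]].
      exists ((S `&` S') `&` ~` (W `|` W')).
        exists (S `&` S'), (W `|` W'); split=> //; first exact: definableI.
          exact: definableU.
        exact: forkedU.
      by move=> x [[? ?]]; rewrite setCU => -[].
    + move=> _ [S [W [Sd Sc Wd Wf ->]]]; apply: contrapT => /forallNP SW; apply: nf.
      apply: tp_extends_forked Sd Sc _; apply: forked_sub Wf => x Sx.
      by apply: contrapT => nWx; case: (SW x).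
  - move=> _ [S [W [Sd Sc Wd Wf ->]]]; apply: definableI; first exact: definable_sub Sd.
    exact: definableC.
exists c; split.
  apply/tp_definable => S Sd Sc.
  have [] // : (S `&` ~` set0) c; apply: cF; exists S, set0; split=> //.
    by rewrite -[set0]setCK setC0; apply/definableC/definableT.
  exact: forked0.
move=> /(forks_formula Vs Xs)[W [Wd Wc Wf]].
have [] // : (setT `&` ~` W) c; apply: cF; exists setT, W; split=> //.
exact: definableT.
Qed.

Hypothesis Chom : strongly_homogeneous C K.

Lemma homogeneous_tuple (n : nat) (A : set C) (c c' : 'I_n -> C) :
  small K A -> tp A c = tp A c' ->
  exists2 g, automorphism g & (forall a, A a -> g a = a) /\ g \o c = c'.
Proof.
move=> As E; pose X := A `|` range c.
have Xs : small K X by apply/small_setU/small_finite/finite_image/finite_finset.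
(* Each element of [X] gets a name, a coordinate of [c] or an element of [A]; [f] reads the same
   name with [c'] in place of [c]. *)
have /choice[r rP] : forall x : X, exists z : 'I_n + A, copair c val z = val x.
  move=> x; have [Ax|[i _ ix]] : X (val x) := set_valP x.
    by exists (inr (SigSub (mem_set Ax))).
  by exists (inl i).
pose f : X -> C := copair c' val \o r.
have fE : elementary_map f.
  move=> phi; have -> : (fun a : X => val a) = copair c val \o r.
    by apply/funext => x /=; rewrite rP.
  have := congr1 (fun p => p (rename r phi)) E; rewrite /tp /= => H.
  by rewrite -!sat_rename H.
(* The chosen name does not matter: coincidences between names are equations in the common type. *)
have cc' (z z' : 'I_n + A) : copair c val z = copair c val z' ->
    copair c' val z = copair c' val z'.
  by move=> H; have : tp A c' (Equal (Var _ z) (Var _ z')) by rewrite -E.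
have [g gaut gf] := Chom Xs fE.
exists g => //.
have gP z : g (copair c val z) = copair c' (val : A -> C) z.
  have Xz : X (copair c val z).
    by case: z => [i|a]; [right; exists i|left; apply: set_valP].
  by rewrite -[copair c val z]/(val (SigSub (mem_set Xz))) gf; apply: cc'; rewrite rP.
split=> [a Aa|]; first exact: (gP (inr (SigSub (mem_set Aa)))).
by apply/funext => i; apply: (gP (inl i)).
Qed.

(* Dual finite character only speaks about one realization [c]; homogeneity moves its
   witness to any other realization of [tp(c/A)]. *)
Lemma forking_formula_transfer (n m : nat) (A : set C) (c c' : 'I_n -> C)
    (phi : formula L (('I_n + 'I_m) + A)) :
  small K A -> tp A c = tp A c' ->
  (forall b, sat phi (copair (copair c b) val) -> forks A (tp (A `|` range b) c)) ->
  forall b, sat phi (copair (copair c' b) val) -> forks A (tp (A `|` range b) c').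
Proof.
move=> As E H b Hb; have [g gaut [gA gc]] := homogeneous_tuple As E.
case: (gaut) => [[h gK hK] _ _].
(* The tuple [b] is pulled back along the inverse [h] of [g], the hypothesis is applied at [c], and
   the resulting forking formula is pushed forward along [g]. *)
have hb : forks A (tp (A `|` range (h \o b)) c).
  apply: H; rewrite -(sat_automorphism _ _ gaut); congr (sat phi _): Hb.
  apply/funext => -[[x|x]|x] /=; [by rewrite -gc|by rewrite hK|].
  by rewrite gA //; apply: set_valP.
have [||S [Sd Sc Sf]] := forks_formula _ _ hb.
- by apply: small_finite => //; apply: finite_finset.
- by apply: small_setU => //; apply/small_finite/finite_image/finite_finset.
apply: tp_extends_forked (forked_automorphism gaut gA Sf).
  apply: definable_sub (definable_automorphism gaut Sd).
  move=> _ [a [Aa|[i _ <-]] <-]; first by left; rewrite gA.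
  by right; exists i => //=; rewrite hK.
by exists c.
Qed.

End Forked.

(** * Limits along an ultrafilter *)

Lemma nonprincipal_ultrafilter :
  exists U : set (set nat), UltraFilter U /\ forall N, U [set j | N < j].
Proof.
have FF : ProperFilter (filter_from [set: nat] (fun N => [set j | N < j])).
  apply: filter_from_proper => [|N _]; last by exists N.+1 => /=.
  apply: filter_from_filter; first by exists 0.
  move=> M N _ _; exists (maxn M N) => // j /=.
  by rewrite gtn_max => /andP.
have [U [UU FU]] := ultraFilterLemma FF.
by exists U; split=> // N; apply: FU; exists N.
Qed.

Section Average.
Variables (U : set (set nat)) (UU : UltraFilter U).
Hypothesis Ugt : forall N, U [set j | N < j].
Variables (d : Order.disp_t) (I : orderType d).
Implicit Types (t s : seq I) (P Q : set (I -> nat)) (f : I -> nat).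

Definition update f (x : I) (j : nat) : I -> nat :=
  fun y => if y == x then j else f y.

(** Iterated quantifier [for U-many values] over the indices in [t], the head outermost; [f]
    supplies the values outside [t]. *)
Fixpoint average t P f : Prop :=
  match t with
  | [::] => P f
  | x :: t' => U [set j | average t' P (update f x j)]
  end.

(** Membership of [R] in the [k]-th tensor power of [U]; no index from [I] occurs. *)
Fixpoint iterated k (R : set (seq nat)) : Prop :=
  match k with
  | 0 => R [::]
  | k'.+1 => U [set j | iterated k' [set r | R (j :: r)]]
  end.

Lemma averageS t P Q f : P `<=` Q -> average t P f -> average t Q f.
Proof.
move=> PQ; elim: t f => [|x t IH] f /=; first exact: PQ.
by apply: filterS => j; apply: IH.
Qed.

Lemma averageI t P Q f : average t P f -> average t Q f -> average t (P `&` Q) f.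
Proof.
elim: t f => [|x t IH] f //= HP HQ.
by apply: filterS (filterI HP HQ) => j [? ?]; apply: IH.
Qed.

Lemma averageC t P f : ~ average t P f -> average t (~` P) f.
Proof.
elim: t f => [|x t IH] f //= nP.
have [//|] := in_ultra_setVsetC [set j | average t P (update f x j)] UU.
by apply: filterS => j; apply: IH.
Qed.

Lemma average_ex t P f : average t P f -> exists f', P f'.
Proof.
elim: t f => [|x t IH] f /=; first by exists f.
by move=> /filter_ex[j]; apply: IH.
Qed.

(** Since [U] contains every tail of [nat], each value can be taken above the one just chosen; the
    bound [N] carries that value through the induction. *)
Lemma average_increasing t f N : sorted <%O t ->
  average t [set f' | [/\ forall x, x \notin t -> f' x = f x,
    forall x, x \in t -> N < f' x &
    forall x y, x \in t -> y \in t -> (x < y)%O -> f' x < f' y]] f.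
Proof.
elim: t f N => [|x t IH] f N /= ts; first by split.
have xt := order_path_min lt_trans ts.
apply: filterS (Ugt N) => j /= Nj.
apply: averageS (IH (update f x j) j (path_sorted ts)) => f' [f'out f'gt f'inc].
have f'x : f' x = j.
  rewrite f'out /update ?eqxx //; apply/negP => /(allP xt).
  by rewrite ltxx.
split=> [y|y|y z]; rewrite !inE.
- by rewrite negb_or => /andP[yx /f'out ->]; rewrite /update (negbTE yx).
- by move=> /orP[/eqP->|/f'gt/(ltn_trans Nj)//]; rewrite f'x.
- move=> /orP[/eqP->|yt] /orP[/eqP->|zt] yz; rewrite ?f'x.
  + by rewrite ltxx in yz.
  + exact: f'gt.
  + by have := lt_trans yz (allP xt _ yt); rewrite ltxx.
  + exact: f'inc.
Qed.

(** The source of indiscernibility: the right side depends only on the length of [s]. Quantifiers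
    over indices outside [s] are vacuous because [U] is a proper filter. *)
Lemma average_iterated t s (R : set (seq nat)) f : sorted <%O t -> subseq s t ->
  average t [set f' | R (map f' s)] f <-> iterated (size s) R.
Proof.
elim: t s R f => [|x t IH] s R f ts /=; first by move=> /eqP->.
have xt : x \notin t.
  by apply/negP => /(allP (order_path_min lt_trans ts)); rewrite ltxx.
have {}ts := path_sorted ts.
case: s => [|y s] /=; [|case: eqP => [->|_] st].
- move=> _; have E j := IH [::] R (update f x j) ts (sub0seq t).
  split=> [/filter_ex[j /E]//|HR]; apply: filterS filterT => j _.
  exact/E.
- have E j : average t [set f' | R (f' x :: map f' s)] (update f x j) <->
      iterated (size s) [set r | R (j :: r)].
    rewrite -(IH s [set r | R (j :: r)] (update f x j)) //.
    (* Only its first clause is used: since [x] is not in [t], later choices keep the value [j] at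
       [x]. *)
    have Hfix := average_increasing (update f x j) 0 ts.
    by split=> H; apply: averageS (averageI Hfix H) => f' [[/(_ x xt) fx _ _]];
      rewrite /= fx /update eqxx.
  by split; apply: filterS => j /E.
- have E j := IH (y :: s) R (update f x j) ts st.
  split=> [/filter_ex[j /E]//|HR]; apply: filterS filterT => j _.
  exact/E.
Qed.

End Average.

Section LimitSequence.
Variables (L : language) (C : structure L) (K : Type).
Hypotheses (natK : small K [set: nat]) (Csat : saturated C K).
Variables (d : Order.disp_t) (I : orderType d) (n : nat) (B : set C).
Hypotheses (Is : small K [set: I]) (Bs : small K B).

Lemma small_index : small K [set: I * 'I_n].
Proof.
apply: small_le (small_prod_nat natK Is); apply/card_leTT.
by exists (fun x => (x.1, val x.2)) => -[x i] [y j] [-> /val_inj ->].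
Qed.

Lemma increasing_sorted k (i : 'I_k -> I) :
  increasing i -> sorted <%O [seq i l | l <- enum 'I_k].
Proof.
move=> iinc; rewrite sorted_map; apply: (@sub_sorted _ (fun l l' : 'I_k => (l < l')%N)).
  by move=> l l' ll'; apply: iinc.
have := iota_ltn_sorted 0 k; rewrite -val_enum_ord sorted_map.
exact: sub_sorted.
Qed.

Lemma sorted_subseq (s t : seq I) :
  sorted <%O s -> sorted <%O t -> {subset s <= t} -> subseq s t.
Proof.
move=> ss ts st; suff -> : s = [seq x <- t | x \in s] by apply: filter_subseq.
apply: (irr_sorted_eq lt_trans ltxx ss (sorted_filter lt_trans _ ts)) => x.
by rewrite mem_filter /=; case xs: (x \in s); rewrite //= st.
Qed.

(* The type of [b] is the limit of the types of increasing subsequences of [a] along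
   a nonprincipal ultrafilter; iterating the ultrafilter replaces Ramsey's theorem. *)
Lemma indiscernible_limit (a : nat -> 'I_n -> C) :
  exists b : I -> 'I_n -> C, indiscernible B b /\
    forall S : set (I * 'I_n -> C), definable B S -> S (fun x => b x.1 x.2) ->
    forall t : seq I, exists f : I -> nat,
      (forall x y, x \in t -> y \in t -> (x < y)%O -> f x < f y) /\
      S (fun x => a (f x.1) x.2).
Proof.
have [U [UU Ugt]] := nonprincipal_ultrafilter.
pose pull (S : set (I * 'I_n -> C)) := [set f : I -> nat | S (fun x => a (f x.1) x.2)].
(* The limit type: definable sets whose average holds along every sufficiently large finite set of
   indices, enumerated in increasing order. *)
pose F := [set S | definable B S /\ exists t : seq I, forall t', sorted <%O t' ->
  {subset t <= t'} -> forall f, average U t' (pull S) f].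
pose mk (t : seq I) := sort <=%O (undup t).
have mks t : sorted <%O (mk t) by rewrite sort_lt_sorted undup_uniq.
have mksub t : {subset t <= mk t} by move=> x; rewrite mem_sort mem_undup.
have [v vF] : exists v, forall S, F S -> S v.
  apply: (compactness natK Csat (X := B)) => // [||S []//]; first exact: small_index.
  split.
  - exists setT; split; first exact: definableT.
    exists [::] => t' ts' _ f.
    by apply: averageS (average_increasing UU Ugt f 0 ts').
  - move=> S S' [Sd [t tP]] [Sd' [t' tP']]; exists (S `&` S') => //.
    split; first exact: definableI.
    exists (t ++ t') => t'' ts'' tt f.
    apply: (averageI UU); [apply: tP|apply: tP'] => // x xt; apply: tt;
      by rewrite mem_cat xt ?orbT.
  - move=> S [_ [t tP]].
    have /average_ex[f Sf] := tP (mk t) (mks t) (@mksub t) (fun=> 0).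
    by eexists; apply: Sf.
exists (fun x i => v (x, i)).
have vE : (fun x => v (x.1, x.2)) = v by apply/funext => -[].
split.
  have aux k (i j : 'I_k -> I) (S : set ('I_k * 'I_n -> C)) : increasing i ->
      increasing j -> definable B S -> S (fun x => v (i x.1, x.2)) ->
      S (fun x => v (j x.1, x.2)).
    move=> iinc jinc Sd Si.
    pose at_ (i : 'I_k -> I) (w : I * 'I_n -> C) (x : 'I_k * 'I_n) := w (i x.1, x.2).
    have atd i' T : definable B T -> definable B (at_ i' @^-1` T).
      apply: definable_preimage => // x; left; exists (i' x.1, x.2) => //.
    pose R := [set r : seq nat | S (fun x => a (nth 0 r x.1) x.2)].
    have pullE i' : pull (at_ i' @^-1` S) =
        [set f | R (map f [seq i' l | l <- enum 'I_k])].
      apply/funext => f; rewrite /pull /R /at_ /=.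
      congr (S _); apply/funext => -[l m] /=.
      by rewrite -map_comp (nth_map l) ?size_enum_ord // nth_ord_enum.
    (* Whether [S] holds on average at an increasing tuple is the same statement [iterated U k R]
       for all such tuples, so [i] and [j] cannot be told apart. *)
    have avgE i' t f : increasing i' -> sorted <%O t ->
        {subset [seq i' l | l <- enum 'I_k] <= t} ->
        average U t (pull (at_ i' @^-1` S)) f <-> iterated U k R.
      move=> inc' ts sub; rewrite pullE average_iterated //; last first.
        by apply: sorted_subseq => //; apply: increasing_sorted.
      by rewrite size_map size_enum_ord.
    have [HR|nR] := pselect (iterated U k R).
      apply: (vF (at_ j @^-1` S)); split; first exact: atd.
      by exists [seq j l | l <- enum 'I_k] => t ts sub f; apply/avgE.
    exfalso; apply: (vF (at_ i @^-1` (~` S)) _ Si).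
    split; first exact/atd/definableC.
    exists [seq i l | l <- enum 'I_k] => t ts sub f.
    have := @averageC U UU _ _ t (pull (at_ i @^-1` S)) f; apply.
    by move/avgE => H; apply/nR/H.
  move=> k i j iinc jinc; apply/tp_definable => S Sd.
  exact: (aux k i j S iinc jinc Sd).
(* The average concentrates on maps increasing on [t]; if none of them satisfied [S], the complement
   of [S] would belong to [F]. *)
move=> S Sd; rewrite vE => Sv t; apply: contrapT => nf.
apply: (vF (~` S) _ Sv); split; first exact: definableC.
exists t => t' ts' tt' f.
apply: averageS (average_increasing UU Ugt f 0 ts') => f' [_ _ f'inc] Sf'.
by apply: nf; exists f'; split=> // x y /tt' ? /tt'; apply: f'inc.
Qed.

End LimitSequence.

(** * Independent sequences and existence of Morley sequences *)

Lemma nonforking_sequence (L : language) (C : structure L) (K : Type)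
    (n : nat) (A B : set C) (c0 : 'I_n -> C) :
  small K [set: nat] -> saturated C K -> small K B -> ~ forks A (tp B c0) ->
  exists a : nat -> 'I_n -> C, forall i, tp B c0 = tp B (a i) /\
    ~ forks A (tp (B `|` \bigcup_(j in [set j | j < i]) range (a j)) (a i)).
Proof.
move=> natK Csat Bs nf.
(* The next term is chosen as a function of the finite set [Y] of entries so far; [c0] is a dummy
   value at infinite sets. *)
have /choice[G GP] : forall Y : set C, exists c, finite_set Y ->
    tp B c0 = tp B c /\ ~ forks A (tp (B `|` Y) c).
  move=> Y; have [Yfin|nYfin] := pselect (finite_set Y); last by exists c0.
  have [//| |||c cP] := @nonforking_extension L C K natK Csat 'I_n A B (B `|` Y) c0.
  - exact/small_finite/finite_finset.
  - exact/small_setU/small_finite.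
  - by left.
  - exact: nf.
  by exists c.
pose Y i := iter i (fun Y => Y `|` range (G Y)) set0.
have Yfin i : finite_set (Y i).
  elim: i => [|i IH] /=; first exact: finite_set0.
  by rewrite finite_setU; split=> //; apply/finite_image/finite_finset.
exists (fun i => G (Y i)) => i.
suff -> : \bigcup_(j in [set j | j < i]) range (G (Y j)) = Y i by apply: GP.
elim: i => [|i IH] /=; first by apply/seteqP; split=> // x [].
rewrite -IH; apply/seteqP; split=> [x [j /=]|x].
  rewrite ltnS leq_eqVlt => /orP[/eqP->|ji] xj; last by left; exists j.
  by right; rewrite IH.
case=> [[j /= ji xj]|xi]; first by exists j => //=; apply: ltnW.
by exists i => //=; rewrite IH in xi.
Qed.

Theorem theorem5 (L : language) (T : set (sentence L)) (K : Type) (C : structure L)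
  (hT : complete_theory T) (hC : monster C K T)
  (hdfc : dual_finite_character C K)
  (A B : set C) (hA : small K A) (hB : small K B) (hAB : A `<=` B)
  (n : nat) (p : set (formula L ('I_n + B)))
  (hp : complete_type p) (hnf : ~ forks A p)
  (d : Order.disp_t) (I : orderType d) (hI : small K [set: I]) :
  exists b : I -> 'I_n -> C, morley_sequence A p b.
Proof.
case: hC => _ Ks Csat Chom.
have natK : small K [set: nat].
  by apply: small_le Ks; apply/card_leTT; exists inr => x y [].
have [c0 c0p] := Csat B n p hB hp.
have pE : p = tp B c0.
  apply/seteqP; split=> phi; first exact: c0p.
  by move=> Hphi; case: (hp.2 phi) => [//|/c0p nphi]; case: (nphi Hphi).
move: hnf; rewrite pE => hnf.
have [a aP] := nonforking_sequence natK Csat hB hnf.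
have [b [bind bP]] := indiscernible_limit natK Csat hI hB a.
exists b; split=> // i.
(* All terms of [a] have type [p] over [B], so a formula failing at [b i] would fail at some term of
   [a]; no order constraint is needed, hence the empty list. *)
have bi : tp B c0 = tp B (b i).
  apply/tp_definable => S Sd Sc0; apply: contrapT => nSi.
  pose at_ (w : I * 'I_n -> C) l := w (i, l).
  have [||f [_ nS]] := bP (at_ @^-1` (~` S)) _ _ [::].
  - apply: definable_preimage (definableC Sd) => // x; left; exists (i, x) => //.
  - exact: nSi.
  exact/nS/((tp_definable B c0 (a (f i))).1 (aP (f i)).1 S Sd Sc0).
split; first exact/realizes_tp.
have fin k : small K [set: 'I_k] by apply: small_finite => //; apply: finite_finset.
have bs : small K (before b i).
  apply: small_sub (_ : _ `<=` range (fun x : I * 'I_n => b x.1 x.2)) _ => [x|].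
    by move=> [j _ [l _ <-]]; exists (j, l).
  exact/small_range/small_index.
move=> /(forks_formula natK Csat (fin n) (small_setU natK hB bs))[S [Sd Sbi Sf]].
have [Y [/(@finite_seqP {classic C})[s sE] YX Yd]] := definable_finite Sd.
(* The finitely many parameters of the forking formula form the tuple to which dual finite character
   applies. *)
pose y (l : 'I_(size s)) : C := tnth (in_tuple (s : seq {classic C})) l.
have yY : range y = Y.
  rewrite sE; apply/seteqP; split=> [_ [l _ <-]|x /=]; first exact: mem_tnth.
  by move=> /(@tnthP _ _ (in_tuple s))[l ->]; exists l.
have := @hdfc A (size s) n y (b i) hA.
case.
  by apply: tp_extends_forked Sbi Sf; apply: definable_sub Yd; rewrite yY; right.
move=> phi [phib phiP].
(* Each entry of [y] is traced to a coordinate of an earlier term of [b] or to an element of [B],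
   which turns [phi] into a condition [h] on the whole sequence. *)
have /choice[z zP] : forall l, exists z : I * 'I_n + C,
    match z with
    | inl q => (q.1 < i)%O /\ y l = b q.1 q.2
    | inr c => B c /\ y l = c
    end.
  move=> l; have [|By|[j ji [m _ bjm]]] := YX (y l); first by rewrite -yY; exists l.
    by exists (inr (y l)).
  by exists (inl (j, m)).
pose h (w : I * 'I_n -> C) : 'I_n + 'I_(size s) -> C :=
  copair (fun l => w (i, l)) (fun l => copair w id (z l)).
have hd : definable B (h @^-1` [set w | sat phi (copair w val)]).
  apply: (@definable_preimage _ _ _ _ A) => //; last by exists phi.
  move=> [l|l]; first by left; exists (i, l).
  rewrite /h /=; case: (z l) (zP l) => [q _|c [Bc _]]; first by left; exists q.
  by right; exists c.
(* Listing [i] with all indices used in [y] forces [f] to send the latter below [f i], so the copy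
   [y'] lies in [B] and the terms of [a] before [f i]. *)
pose t := i :: pmap (fun l => if z l is inl q then Some q.1 else None)
  (enum 'I_(size s)).
have [|f [finc fphi]] := bP _ hd _ t.
  rewrite /= /h; congr (sat phi _): phib; apply/funext => -[[l|l]|c] //=.
  by case: (z l) (zP l) => [q []|c []].
pose y' l := copair (fun x : I * 'I_n => a (f x.1) x.2) id (z l).
have y'X : A `|` range y' `<=` B `|` \bigcup_(j in [set j | j < f i]) range (a j).
  move=> c [/hAB Bc|[l _ <-]]; first by left.
  rewrite /y'; case zl: (z l) (zP l) => [q|c'] /= [qi _]; last by left.
  right; exists (f q.1); last by exists q.2.
  apply: finc => //; rewrite /t inE ?eqxx //; apply/orP; right.
  by rewrite mem_pmap; apply/mapP; exists l; rewrite ?mem_enum ?zl.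
have [ai nai] := aP (f i); apply: nai.
have Aai : tp A (b i) = tp A (a (f i)) by apply: tp_sub hAB _; rewrite -bi.
have /forks_formula : forks A (tp (A `|` range y') (a (f i))).
  exact: (forking_formula_transfer natK Csat Chom hA Aai phiP).
case/(_ K natK Csat (fin n)).
  by apply: small_setU => //; apply: small_range.
move=> S' [Sd' Sa' Sf']; apply: tp_extends_forked Sf' => //.
exact: definable_sub Sd'.
Qed.
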